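(* Let $G$ be a finite connected loopless undirected multigraph of genus $g=|E(G)|-|V(G)|+1$, let $K$ be the canonical divisor of $G$, and let $D$ be a divisor on $G$. If $\deg(D)=g-1$ then $r(D)=r(K-D)$.
   Context: A divisor on $G$ is a function $D:V(G)\to\mathbb{Z}$; $\deg(D)=\sum_vD(v)$; $D$ is effective if $D\ge0$ pointwise. The canonical divisor is $K(v)=\deg(v)-2$, where $\deg(v)$ is the number of edges incident to $v$. Two divisors are linearly equivalent if their difference lies in the $\mathbb{Z}$-span of the columns of the Laplacian matrix of $G$. The (Baker--Norine) rank $r(D)$ is $\min\deg(E)-1$ over all effective $E$ such that $D-E$ is not linearly equivalent to any effective divisor. *)

(* Defs.v *)
From HB Require Import structures.
From mathcomp Require Import all_boot all_order all_algebra.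
From mathcomp Require Import boolp.

Set Implicit Arguments.
Unset Strict Implicit.
Unset Printing Implicit Defensive.

Import Order.TTheory GRing.Theory Num.Theory.
Local Open Scope ring_scope.

(* Edges form a type of their own, so parallel edges are allowed; requiring
   exactly two endpoints rules out loops.  The vertex set is nonempty: without
   vertices the minimum defining the rank would range over the empty set. *)
Record multigraph := Multigraph {
  vertex : finType;
  edge : finType;
  ends : edge -> {set vertex};
  card_ends : forall e, #|ends e| = 2;
  card_vertex_gt0 : (0 < #|vertex|)%N
}.

Section Divisors.

Variable G : multigraph.
Implicit Types u v : vertex G.

Definition edges_at v : {set edge G} := [set e | v \in ends e].

Definition edges_between u v : {set edge G} :=
  [set e | ends e == [set u; v]].

Definition adjacent : rel (vertex G) :=
  fun u v => edges_between u v != set0.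

Definition connected : Prop := forall u v, connect adjacent u v.

Definition genus : int := #|edge G|%:Z - #|vertex G|%:Z + 1.

Definition divisor : Type := {ffun vertex G -> int}.

HB.instance Definition _ := GRing.Zmodule.on divisor.

Implicit Types D E : divisor.

Definition deg D : int := \sum_v D v.

Definition effective D : Prop := forall v, 0 <= D v.

Definition canonical : divisor := [ffun v => #|edges_at v|%:Z - 2].

Definition laplacian u v : int :=
  if u == v then #|edges_at v|%:Z else - #|edges_between u v|%:Z.

Definition laplacian_col v : divisor := [ffun u => laplacian u v].

Definition lin_equiv D E : Prop :=
  exists c : vertex G -> int, D - E = \sum_v laplacian_col v *~ c v.

Definition equiv_effective D : Prop :=
  exists2 E, effective E & lin_equiv D E.

Lemma degB D E : deg (D - E) = deg D - deg E.
Proof. by rewrite /deg -sumrB; apply: eq_bigr => v _; rewrite !ffunE. Qed.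

Lemma deg_laplacian_col v : deg (laplacian_col v) = 0.
Proof.
rewrite /deg (bigD1 v) //= ffunE /laplacian eqxx.
under eq_bigr => u /negbTE uv do rewrite ffunE /laplacian uv.
rewrite sumrN; apply/eqP; rewrite subr_eq0; apply/eqP.
rewrite -(big_morph Posz PoszD (erefl _)); congr Posz.
under eq_bigr => u _ do rewrite -sum1_card.
rewrite -sum1_card (exchange_big_dep [in edges_at v]) /=; last first.
  by move=> u e _; rewrite !inE => /eqP->; rewrite !inE eqxx orbT.
apply: eq_bigr => e; rewrite inE => ve.
have /cards2P[x [y [xy def_e]]]: #|ends e| == 2 by rewrite card_ends.
have [u uv def_e']: exists2 u, u != v & ends e = [set u; v].
  move: ve; rewrite def_e !inE => /orP[]/eqP->; last by exists x.
  by exists y; rewrite 1?eq_sym // setUC.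
rewrite (big_pred1 u) // => w; rewrite /= inE def_e'.
apply/andP/eqP => [[wv /eqP eq_ends]|->]; last by rewrite uv eqxx.
by have := set21 w v; rewrite -eq_ends !inE (negbTE wv) orbF => /eqP.
Qed.

Lemma deg_lin_equiv D E : lin_equiv D E -> deg D = deg E.
Proof.
case=> c DE; apply/eqP; rewrite -subr_eq0 -degB DE; apply/eqP.
rewrite /deg; under eq_bigr => u _ do rewrite sum_ffunE.
rewrite exchange_big /= big1 // => v _.
have ffunMz (f : divisor) (z : int) u : (f *~ z) u = f u *~ z.
  have ffunMn n : (f *+ n) u = f u *+ n.
    by elim: n => [|n IHn]; rewrite ?mulr0n ?ffunE // !mulrSr ffunE IHn.
  by case: z => n; rewrite ?NegzE ?mulrNz ?[in LHS]ffunE -!pmulrn ffunMn.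
under eq_bigr => u _ do rewrite ffunMz.
by rewrite -mulrz_suml -[X in X *~ _]/(deg _) deg_laplacian_col mul0rz.
Qed.

Lemma rank_exists D : exists n : nat,
  `[< exists E, [/\ effective E, deg E = n%:Z & ~ equiv_effective (D - E)] >].
Proof.
have /card_gt0P[v0 _] := card_vertex_gt0 G.
pose n := `|deg D|.+1%N; exists n; apply/asboolP.
pose E : divisor := [ffun v => if v == v0 then n%:Z else 0].
have degE : deg E = n%:Z.
  rewrite /deg (bigD1 v0) //= ffunE eqxx big1 ?addr0 // => v /negbTE vv0.
  by rewrite ffunE vv0.
exists E; split=> //; first by move=> v; rewrite ffunE; case: ifP.
case=> F F_ge0 /deg_lin_equiv; rewrite degB degE => degF.
have : 0 <= deg F by apply: sumr_ge0 => v _; apply: F_ge0.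
rewrite -degF subr_ge0 leNgt => /negP; apply.
by rewrite (le_lt_trans (ler_norm _)) // /n -abszE ltz_nat.
Qed.

Definition rank D : int := (ex_minn (rank_exists D))%:Z - 1.

End Divisors.

(* Main.v *)
From mathcomp Require Import boolp zify ring.
Require Import Defs.
From mathcomp Require Import all_boot all_order all_algebra.

Set Implicit Arguments.
Unset Strict Implicit.
Unset Printing Implicit Defensive.

Import Order.TTheory GRing.Theory Num.Theory.
Local Open Scope ring_scope.

(* For an ordering p of the vertices let nu p v be the number of edges from v
   to p-smaller vertices, minus 1.  Then deg (nu p) = g - 1, and K - nu p is the
   divisor of the opposite ordering.  No nu p is equivalent to an effective
   divisor (look at the p-first vertex where a firing script is maximal), and
   every D not equivalent to an effective divisor is equivalent to some D'
   with D' <= nu p pointwise: take D' reduced at a vertex and let p be a burning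
   order (Dhar).  If now E is effective of least degree with D - E not
   equivalent to an effective divisor and D - E ~ D' <= nu p, then
   F := nu p - D' is effective, deg F = deg E, and
   K - D - F ~ (K - nu p) - E is not equivalent to an effective divisor, whence
   r(K - D) <= r(D).  The converse inequality follows by symmetry. *)

(** * The Laplacian as an operator on firing scripts *)

Section Laplacian.

Variable G : multigraph.
Implicit Types (u v w q : vertex G) (D E : divisor G) (c : vertex G -> int).
Implicit Types (A T : {set vertex G}).

Definition mult u v : int := #|edges_between u v|%:Z.

Lemma mult_ge0 u v : 0 <= mult u v. Proof. by []. Qed.

Lemma multC u v : mult u v = mult v u.
Proof. by rewrite /mult /edges_between setUC. Qed.

Lemma mult_loop v : mult v v = 0.
Proof.
rewrite /mult [edges_between v v](_ : _ = set0) ?cards0 //.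
apply/setP=> e; rewrite !inE; apply/negP=> /eqP ends_e.
by have := card_ends e; rewrite ends_e setUid cards1.
Qed.

Lemma mult_adjacent u v : adjacent u v -> 1 <= mult u v.
Proof. by rewrite /adjacent -card_gt0. Qed.

Lemma card_edges_at v : #|edges_at v|%:Z = \sum_w mult v w.
Proof.
rewrite (bigD1 v) //= mult_loop add0r.
have := deg_laplacian_col v; rewrite /deg (bigD1 v) //= ffunE /laplacian eqxx.
under eq_bigr => u /negbTE uv do
  rewrite ffunE /laplacian uv -/(mult u v) multC.
by rewrite sumrN => /eqP; rewrite subr_eq0 => /eqP.
Qed.

Definition laplace c : divisor G :=
  [ffun u => \sum_w mult u w * (c u - c w)].

Lemma divisorBE D E u : (D - E) u = D u - E u.
Proof. by rewrite !ffunE. Qed.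

Lemma divisorMzE D (z : int) u : (D *~ z) u = z * D u.
Proof.
have divisorMnE n : (D *+ n) u = n%:Z * D u.
  by elim: n => [|n IHn]; rewrite ?mulr0n ?ffunE ?mul0r // mulrSr ffunE IHn; ring.
by case: z => n; rewrite ?NegzE ?mulrNz ?ffunE -!pmulrn divisorMnE ?mulNr.
Qed.

Lemma laplaceE c : \sum_v laplacian_col v *~ c v = laplace c.
Proof.
apply/ffunP=> u; rewrite sum_ffunE ffunE.
under eq_bigr => v _ do rewrite divisorMzE ffunE.
rewrite (bigD1 u) //= /laplacian eqxx card_edges_at.
under eq_bigr => v vu do rewrite eq_sym (negbTE vu) -/(mult u v) mulrN.
rewrite sumrN mulr_sumr (bigD1 u) //= [RHS](bigD1 u) //= mult_loop mulr0 mul0r.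
by rewrite !add0r -sumrB; apply: eq_bigr => v _; ring.
Qed.

Lemma lin_equivP D E : lin_equiv D E <-> exists c, D - E = laplace c.
Proof. by split=> -[c DE]; exists c; rewrite DE laplaceE. Qed.

Lemma equiv_effectiveP D :
  equiv_effective D <-> exists c, forall v, laplace c v <= D v.
Proof.
split=> [[E E_ge0 /lin_equivP[c DE]]|[c le_cD]].
  exists c => v; have := E_ge0 v; have : (D - E) v = laplace c v by rewrite DE.
  by rewrite divisorBE; lia.
exists (D - laplace c); last by apply/lin_equivP; exists c; rewrite subKr.
by move=> v; rewrite divisorBE subr_ge0.
Qed.

Lemma laplaceD c c' u : laplace (fun v => c v + c' v) u = laplace c u + laplace c' u.
Proof. by rewrite !ffunE -big_split; apply: eq_bigr => w _ /=; ring. Qed.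

Lemma laplaceZ (k : int) c u : laplace (fun v => k * c v) u = k * laplace c u.
Proof. by rewrite !ffunE mulr_sumr; apply: eq_bigr => w _ /=; ring. Qed.

(** The script that fires [A] once: subtracting its Laplacian sends one chip along each edge leaving
    [A]. *)
Definition fire A v : int := (v \in A)%:R.

Lemma laplace_fire_in A v :
  v \in A -> laplace (fire A) v = \sum_(w | w \notin A) mult v w.
Proof.
move=> vA; rewrite ffunE [RHS]big_mkcond; apply: eq_bigr => w _.
by rewrite /fire vA; case: (w \in A); rewrite ?subrr ?mulr0 ?subr0 ?mulr1.
Qed.

Lemma laplace_fire_out A v :
  v \notin A -> laplace (fire A) v = - \sum_(w in A) mult v w.
Proof.
move=> /negbTE vA; rewrite ffunE -sumrN [RHS]big_mkcond; apply: eq_bigr => w _.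
by rewrite /fire vA; case: (w \in A); rewrite ?subrr ?mulr0 ?sub0r ?mulrN1.
Qed.

(** The terms with both ends in [A] are antisymmetric and cancel, so only the edges leaving [A]
    remain. *)
Lemma sum_laplace A c : \sum_(v in A) laplace c v =
  \sum_(v in A) \sum_(w | w \notin A) mult v w * (c v - c w).
Proof.
under eq_bigr => v _ do rewrite ffunE (bigID [in A]) /=.
rewrite big_split /=; set S := (X in X + _).
suff: S = - S by move=> SN; rewrite (_ : S = 0) ?add0r //; lia.
rewrite {1}/S exchange_big -sumrN; apply: eq_bigr => v _; rewrite -sumrN.
by apply: eq_bigr => w _; rewrite multC; ring.
Qed.

End Laplacian.

(** * Existence of [q]-reduced divisors *)

Section Reduction.

Variable G : multigraph.
Hypothesis conG : connected G.
Implicit Types (u v w q : vertex G) (D E : divisor G) (c : vertex G -> int).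
Implicit Types (A T : {set vertex G}).

Lemma crossing_edge T u v : u \in T -> v \notin T ->
  exists x y, [/\ x \in T, y \notin T & adjacent x y].
Proof.
move=> uT vT; have /connectP[s] := conG u v.
elim: s u uT => [|x s IHs] u uT /=; first by move=> _ vu; rewrite vu uT in vT.
case/andP=> ux; have [xT|xT] := boolP (x \in T); first exact: IHs.
by move=> _ _; exists u, x.
Qed.

Definition effective_away q D c := forall v, v != q -> laplace c v <= D v.

Lemma exists_effective_away q D : exists c, effective_away q D c.
Proof.
(* [T] is where debt is allowed; it grows from [[set q]] to all vertices, one neighbour at a
   time. *)
pose P T := forall D, (forall v, v \notin T -> 0 <= D v) ->
  exists c, effective_away q D c.
suff: P setT by apply=> v; rewrite inE.
have: P [set q].
  move=> {}D D_ge0; exists (fun=> 0) => v vq; rewrite ffunE big1 => [|w _].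
    by apply: D_ge0; rewrite inE.
  by rewrite subrr mulr0.
have: q \in [set q] by rewrite inE.
have [n] := ubnP #|~: [set q]|.
elim: n [set q] => // n IHn T leTn qT PT.
have [TT|[v]] := set_0Vmem (~: T).
  by move: PT; rewrite -[T]setCK TT setC0.
rewrite inE => /(crossing_edge qT)[x [y [xT yT xy]]].
apply: (IHn (y |: T)); rewrite ?inE ?qT ?orbT //.
  have: (#|~: T| = #|~: (y |: T)|.+1)%N.
    by rewrite setCU setIC -setDE (cardsD1 y (~: T)) inE yT.
  by lia.
move=> {leTn IHn}D D_ge0; pose k : int := `|D y|.
(* firing T repeatedly lifts y out of debt without harming the outside of T *)
have [z zT|c Dc] := PT (D - laplace (fun w => k * fire T w)).
  rewrite divisorBE laplaceZ laplace_fire_out // mulrN opprK.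
  have S_ge0 : 0 <= \sum_(w in T) mult z w by apply: sumr_ge0.
  have [->|zy] := eqVneq z y; last first.
    rewrite addr_ge0 ?mulr_ge0 ?normr_ge0 //.
    by apply: D_ge0; rewrite !inE negb_or zy.
  (* The edge to [x] brings [y] at least one chip per firing, so [k] firings cover its debt. *)
  have : 1 <= \sum_(w in T) mult y w.
    rewrite (bigD1 x) //= -[1]addr0 lerD ?sumr_ge0 //.
    by rewrite multC mult_adjacent.
  by rewrite /k; nia.
exists (fun w => c w + k * fire T w) => z zq.
rewrite laplaceD; have := Dc z zq; rewrite divisorBE; lia.
Qed.

(** Induction along a path from [q]: the bound grows by at most [B] per edge. *)
Lemma effective_away_bounded q D v :
  exists b : int, forall c, effective_away q D c -> c v - c q <= b.
Proof.
pose bounded w := exists b : int, 0 <= b /\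
  forall c, effective_away q D c -> c w - c q <= b.
suff: bounded v by case=> b [_ Hb]; exists b.
have /connectP[s] := conG q v.
have: bounded q by exists 0; split=> // c _; rewrite subrr.
elim: s {1 2 3}q => [|u s IHs] w Hw /=; first by move=> _ ->.
case/andP=> wu; apply: IHs; case: Hw => b [b_ge0 Hb].
pose B : int := \sum_x `|D x|.
have B_ge0 : 0 <= B by rewrite sumr_ge0.
exists (b + B); split=> [|c Dc]; first exact: addr_ge0.
have {}Hb := Hb c Dc; rewrite leNgt; apply/negP=> ltB.
(* On this superlevel set the edge from [u] to [w] alone pushes the sum of [laplace c] above [B],
   yet that sum is at most the sum of [D] there. *)
pose A := [set x | c u <= c x].
have uA : u \in A by rewrite inE.
have wA : w \notin A by rewrite inE; lia.
have qA : q \notin A by rewrite inE; lia.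
have: \sum_(x in A) laplace c x <= B.
  apply: (@le_trans _ _ (\sum_(x in A) D x)).
    by apply: ler_sum => x xA; apply: Dc; apply: contraNneq qA => <-.
  rewrite /B [leRHS](bigID [in A]) /= -[leLHS]addr0 lerD //; last first.
    by rewrite sumr_ge0.
  by apply: ler_sum => x _; apply: ler_norm.
have diff_ge0 x y : x \in A -> y \notin A -> 0 <= mult x y * (c x - c y).
  by rewrite !inE => cx cy; apply: mulr_ge0 => //; lia.
rewrite sum_laplace leNgt => /negP; apply.
rewrite (bigD1 u) //= (bigD1 w) //=.
have := mult_adjacent wu; rewrite multC => wu1.
have : 0 <= \sum_(y | (y \notin A) && (y != w)) mult u y * (c u - c y).
  by apply: sumr_ge0 => y /andP[yA _]; apply: diff_ge0.
have : 0 <= \sum_(x in A | x != u)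
               \sum_(y | y \notin A) mult x y * (c x - c y).
  by apply: sumr_ge0 => x /andP[xA _]; apply: sumr_ge0 => y; apply: diff_ge0.
have ltB' : B < mult u w * (c u - c w) by nia.
by move=> S2_ge0 S1_ge0; rewrite (lt_le_trans ltB') // -addrA lerDl addr_ge0.
Qed.

(** This makes [D - laplace c] a [q]-reduced divisor: firing a nonempty set that avoids [q] puts one
    of its vertices in debt. *)
Definition reduced q D c := effective_away q D c /\
  forall A, A != set0 -> q \notin A ->
    exists2 v, v \in A & D v - laplace c v < \sum_(w | w \notin A) mult v w.

(** Each legal firing of a nonempty set avoiding [q] raises the sum of the [c v - c q], which is
    bounded above, so such firings come to an end. *)
Lemma exists_reduced q D : exists c, reduced q D c.
Proof.
have [b Hb] := fin_all_exists (effective_away_bounded q D).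
pose gap c := \sum_v b v - \sum_v (c v - c q).
have gap_ge0 c : effective_away q D c -> 0 <= gap c.
  by move=> Dc; rewrite subr_ge0; apply: ler_sum => v _; apply: Hb.
have [c0] := exists_effective_away q D.
have [n] := ubnP `|gap c0|%N; elim: n c0 => // n IHn c le_n Dc.
have [[A [A0 qA legal]]|Nlegal] := pselect (exists A, [/\ A != set0, q \notin A &
    forall v, v \in A -> \sum_(w | w \notin A) mult v w <= D v - laplace c v]).
  pose c' v := c v + fire A v.
  have Dc' : effective_away q D c'.
    move=> v vq; rewrite laplaceD; have [vA|vA] := boolP (v \in A).
      by rewrite laplace_fire_in //; have := legal v vA; lia.
    rewrite laplace_fire_out //; have := Dc v vq.
    have : 0 <= \sum_(w in A) mult v w by apply: sumr_ge0.
    lia.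
  apply: (IHn c') => //.
  have : gap c' <= gap c - 1.
    rewrite /gap -addrA lerD2l -opprD lerN2.
    have -> : \sum_v (c' v - c' q) = \sum_v (c v - c q) + #|A|%:Z.
      rewrite -sum1_card (big_morph Posz PoszD (erefl _)).
      rewrite [X in _ + X]big_mkcond -big_split; apply: eq_bigr => v _ /=.
      by rewrite /c' /fire (negbTE qA); case: (v \in A) => /=; lia.
    by rewrite lerD2l lez_nat card_gt0.
  have := gap_ge0 _ Dc'; have := gap_ge0 _ Dc; lia.
exists c; split=> // A A0 qA; apply: contrapT => no_v.
apply: Nlegal; exists A; split=> // v vA; rewrite leNgt; apply/negP => lt_v.
by apply: no_v; exists v.
Qed.

End Reduction.

(** * Divisors attached to vertex orderings *)

Section Orderings.

Variable G : multigraph.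
Implicit Types (u v w q : vertex G) (D E : divisor G) (c : vertex G -> int).
Implicit Types (p : vertex G -> int).

(** Orderings are encoded as injective integer labellings, so that negation gives the opposite
    ordering. *)
Definition ordering_divisor p : divisor G :=
  [ffun v => \sum_(w | p w < p v) mult v w - 1].

Local Notation nu := ordering_divisor.

Lemma ordering_divisorE p v : nu p v = \sum_(w | p w < p v) mult v w - 1.
Proof. by rewrite ffunE. Qed.

Lemma deg_canonical : deg (canonical G) = (genus G - 1) *+ 2.
Proof.
rewrite /deg; under eq_bigr => v _ do rewrite ffunE.
rewrite sumrB sumr_const.
rewrite -(big_morph Posz PoszD (erefl _)).
have -> : (\sum_(v : vertex G) #|edges_at v| = #|edge G| * 2)%N.
  under eq_bigr => v _ do rewrite -sum1_card.
  rewrite (exchange_big_dep predT) //=.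
  rewrite (eq_bigr (fun=> 2%N)) => [|e _]; first by rewrite sum_nat_const.
  transitivity #|ends e|; last exact: card_ends.
  by rewrite -sum1_card; apply: eq_bigl => v; rewrite inE.
rewrite (eq_card (B := vertex G)) // /genus addrK.
by rewrite PoszM -[2 *+ _]mulr_natr natz mulrnBl -[_ *+ 2]mulr_natr
  -[X in _ = _ - X]mulr_natr mulrC; ring.
Qed.

(** Each edge at [v] leads to a smaller or a larger vertex; by injectivity a tie would be a loop. *)
Lemma canonical_sub_ordering p :
  injective p -> canonical G - nu p = nu (fun v => - p v).
Proof.
move=> p_inj; apply/ffunP=> v; rewrite divisorBE ffunE !ordering_divisorE.
rewrite card_edges_at (bigID (fun w => p w < p v)) /=.
suff -> : \sum_(w | ~~ (p w < p v)) mult v w =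
          \sum_(w | - p w < - p v) mult v w by ring.
rewrite big_mkcond [RHS]big_mkcond; apply: eq_bigr => w _.
rewrite ltrN2 -leNgt le_eqVlt (inj_eq p_inj).
by case: eqVneq => //= <-; rewrite mult_loop if_same.
Qed.

(** Every edge is counted at exactly one end, for [p] and for its opposite, so both divisors have
    half the canonical degree. *)
Lemma deg_ordering p : injective p -> deg (nu p) = genus G - 1.
Proof.
move=> p_inj; have := degB (canonical G) (nu p).
rewrite canonical_sub_ordering // deg_canonical.
suff -> : deg (nu (fun v => - p v)) = deg (nu p) by lia.
rewrite /deg; under eq_bigr do rewrite ordering_divisorE.
under [RHS]eq_bigr do rewrite ordering_divisorE.
rewrite !sumrB; congr (_ - _).
rewrite (exchange_big_dep predT) //=; apply: eq_bigr => w _.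
by apply: eq_big => v; rewrite ?ltrN2 // multC.
Qed.

Lemma ordering_not_effective p : injective p -> ~ equiv_effective (nu p).
Proof.
move=> p_inj /equiv_effectiveP[c le_c].
have /card_gt0P[v0 _] := card_vertex_gt0 G.
pose m := [arg max_(v > v0) c v]%O.
have m_max w : c w <= c m by rewrite /m; case: arg_maxP => // x _; apply.
pose u := [arg min_(v < m | c v == c m) p v]%O.
have [/eqP cu u_min] : c u == c m /\ forall w, c w == c m -> p u <= p w.
  by rewrite /u; case: arg_minP => // x.
have := le_c u; apply/negP; rewrite -ltNge !ffunE ltrBlDr ltzD1.
(* Termwise: a [p]-smaller [w] has [c w < c u] by the choice of [u], and the other terms are
   nonnegative by maximality of [c u]. *)
rewrite [leLHS]big_mkcond; apply: ler_sum => w _.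
have := m_max w; have := u_min w; have := mult_ge0 u w; rewrite -cu.
case: ifP => // lt_w; last by nia.
have [->|] := eqVneq (c w) (c u); first by lia.
nia.
Qed.

Lemma exists_dominating_ordering D : connected G -> ~ equiv_effective D ->
  exists c p, injective p /\ forall v, (D - laplace c) v <= nu p v.
Proof.
move=> conG ND; have /card_gt0P[q _] := card_vertex_gt0 G.
have [c [Dc redc]] := exists_reduced conG q D; exists c.
(* Sets containing [q] burn as well: [q] itself is in debt, or else [D] would be equivalent to an
   effective divisor. *)
have burn A : A != set0 ->
    exists2 v, v \in A & D v - laplace c v < \sum_(w | w \notin A) mult v w.
  move=> A0; have [qA|] := boolP (q \in A); last exact: redc.
  exists q => //; apply: (@lt_le_trans _ _ 0); last exact: sumr_ge0.
  rewrite ltNge; apply/negP=> qge0; apply: ND; apply/equiv_effectiveP; exists c.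
  move=> v; have [->|/Dc//] := eqVneq v q.
  by rewrite -subr_ge0.
(* s lists the burnt vertices, the most recently burnt first *)
pose burnt (s : seq (vertex G)) := forall v, v \in s -> D v - laplace c v <
  \sum_(w | (w \in s) && (index v s < index w s)%N) mult v w.
have [s s_all s_burnt] : exists2 s, (forall v, v \in s) & burnt s.
  have: burnt [::] by [].
  have [n] := ubnP #|[set v : vertex G | v \notin [::]]|.
  elim: n [::] => // n IHn s le_n s_burnt.
  have [s0|sN0] := eqVneq [set v | v \notin s] set0.
    by exists s => // v; have := in_set0 v; rewrite -s0 inE => /negbFE.
  have [v] := burn _ sN0; rewrite inE => vs lt_v.
  apply: (IHn (v :: s)).
    move: le_n; rewrite (cardsD1 v) inE vs ltnS; apply: leq_ltn_trans.
    by apply: subset_leq_card; apply/subsetP=> w; rewrite !inE negb_or.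
  move=> u; rewrite inE; have [-> _|uv] /= := eqVneq u v.
    move: lt_v; congr (_ < _); apply: eq_bigl => w.
    rewrite inE negbK in_cons /= eqxx (eq_sym v w).
    by case: (eqVneq w v) => [->|_]; rewrite ?(negbTE vs) ?andbT.
  move=> us; move: (s_burnt u us); congr (_ < _); apply: eq_bigl => w.
  rewrite in_cons /= (eq_sym v u) (negbTE uv) (eq_sym v w).
  by case: (eqVneq w v) => [->|_]; rewrite ?(negbTE vs).
(* The sign makes earlier burnt vertices smaller; the strict burning inequality absorbs the [- 1] in
   [nu]. *)
exists (fun v => - (index v s)%:Z); split=> [u v /eqP|v].
  by rewrite eqr_opp eqz_nat => /eqP; apply: index_inj.
rewrite divisorBE ordering_divisorE -ltzD1 subrK.
move: (s_burnt v (s_all v)); congr (_ < _); apply: eq_bigl => w.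
by rewrite s_all ltrN2 ltz_nat.
Qed.

End Orderings.

(** * Comparison of the two ranks *)

Lemma rank_canonical_sub_le (G : multigraph) (D : divisor G) :
  connected G -> deg D = genus G - 1 -> rank (canonical G - D) <= rank D.
Proof.
move=> conG degD; rewrite /rank lerD2r lez_nat.
case: (ex_minnP (rank_exists D)) => n /asboolP[E [E_ge0 degE NDE]] _.
case: ex_minnP => m _; apply; apply/asboolP.
have [c [p [p_inj le_nu]]] := exists_dominating_ordering conG NDE.
exists (ordering_divisor p - (D - E - laplace c)); split.
- by move=> v; rewrite divisorBE subr_ge0.
- rewrite !degB deg_ordering // degD degE.
  have -> : deg (laplace c) = deg (0 : divisor G).
    by apply: deg_lin_equiv; apply/lin_equivP; exists c; rewrite subr0.
  by rewrite /deg big1 => [|v _]; rewrite ?ffunE //; lia.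
set Np := (X in equiv_effective X).
have -> : Np = ordering_divisor (fun v => - p v) - E - laplace c.
  by rewrite -canonical_sub_ordering //; apply/ffunP=> v; rewrite !divisorBE; ring.
case/equiv_effectiveP=> c' le_c'.
(* Adding back the effective [E] keeps the divisor equivalent to an effective one, through the
   script [c' + c]. *)
apply: (@ordering_not_effective _ (fun v => - p v)).
  by move=> u v /oppr_inj/p_inj.
apply/equiv_effectiveP; exists (fun v => c' v + c v) => v.
have := le_c' v; rewrite laplaceD.
by rewrite !divisorBE; have := E_ge0 v; lia.
Qed.

Theorem corollary5p9 (G : multigraph) (D : divisor G) :
  connected G -> deg D = genus G - 1 -> rank D = rank (canonical G - D).
Proof.
move=> conG degD; apply/le_anti; rewrite rank_canonical_sub_le // andbT.
(* The inequality applies to [canonical G - D], whose degree is again [genus G - 1]. *)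
rewrite -[X in rank X <= _](subKr (canonical G)) rank_canonical_sub_le //.
by rewrite degB deg_canonical degD; lia.
Qed.
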